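(* Let $\Phi=\{\varphi_n\}_{n=1}^N\subseteq\mathbb{C}^M$ and let $\mathcal{A}\colon\mathbb{C}^M/\mathbb{T}\rightarrow\mathbb{R}^N$ be defined by $(\mathcal{A}(x))(n):=|\langle x,\varphi_n\rangle|^2$. If $\mathcal{A}$ is injective, then $\Phi$ satisfies the complement property.
   Context: $\mathbb{T}=\{c\in\mathbb{C}:|c|=1\}$. $\mathbb{C}^M/\mathbb{T}$ denotes $\mathbb{C}^M$ with $x$ and $y$ identified whenever $y=cx$ for some $c\in\mathbb{T}$; injectivity of $\mathcal{A}$ means: $\mathcal{A}(x)=\mathcal{A}(y)$ implies $y=cx$ for some $c\in\mathbb{T}$. The inner product on $\mathbb{C}^M$ is $\langle x,\varphi\rangle=\varphi^*x$. $\Phi=\{\varphi_n\}_{n=1}^N\subseteq\mathbb{C}^M$ satisfies the complement property if for every $S\subseteq\{1,\ldots,N\}$, either $\{\varphi_n\}_{n\in S}$ or $\{\varphi_n\}_{n\in S^{\mathrm{c}}}$ spans $\mathbb{C}^M$ (over $\mathbb{C}$). *)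

(* Defs.v *)
(* MathComp; R[i] over R : realType is the field of complex numbers. *)
From mathcomp Require Import all_boot all_order all_algebra.
From mathcomp Require Import reals complex.

Set Implicit Arguments.
Unset Strict Implicit.
Unset Printing Implicit Defensive.

Import Order.TTheory GRing.Theory Num.Theory.
Import ComplexField.Normc.

Local Open Scope ring_scope.
Local Open Scope complex_scope.
Local Open Scope sesquilinear_scope.

Section PhaseRetrieval.
Variables (R : realType) (M N : nat).
Implicit Types (x y : 'cV[R[i]]_M) (phi : 'I_N -> 'cV[R[i]]_M).

(* Linear in the first argument: <x, f> = f^* x, the entry of a 1 x 1 matrix. *)
Definition inner x (f : 'cV[R[i]]_M) : R[i] := (f ^t* *m x) 0 0.

Definition eq_mod_phase x y : Prop :=
  exists2 c : R[i], normc c = 1 & y = c *: x.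

(* normc is the R-valued modulus, so that the measurements lie in R^N; the map
   is given on representatives and descends to C^M / T by [intensity_phase]. *)
Definition intensity phi x : 'rV[R]_N :=
  \row_(n < N) (normc (inner x (phi n)) ^+ 2).

Definition intensity_injective phi : Prop :=
  forall x y, intensity phi x = intensity phi y -> eq_mod_phase x y.

Definition spans phi (S : {set 'I_N}) : Prop :=
  (<<[seq phi n | n in S]>> = fullv)%VS.

Definition complement_property phi : Prop :=
  forall S : {set 'I_N}, spans phi S \/ spans phi (~: S).

Lemma intensity_phase phi x y :
  eq_mod_phase x y -> intensity phi x = intensity phi y.
Proof.
case=> c c1 ->; apply/rowP => n.
rewrite [LHS]mxE [RHS]mxE /inner -scalemxAr [X in _ = normc X ^+ 2]mxE.
by rewrite normcM c1 mul1r.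
Qed.

End PhaseRetrieval.

(* Main.v *)
Require Import Defs.
From mathcomp Require Import all_boot all_order all_algebra.
From mathcomp Require Import reals complex.

Local Open Scope ring_scope.
Local Open Scope complex_scope.

(** If neither the vectors indexed by S nor those indexed by its complement
    span, pick u <> 0 orthogonal to the former and v <> 0 orthogonal to the
    latter.  Then u + v and u - v have the same intensities, so
    u - v = c (u + v).  Unlike in the real case c need not be 1 or -1, but then
    u and v are proportional, hence orthogonal to every phi n: the intensities
    of v are those of 0, and injectivity gives v = 0. *)

Import GRing.Theory Num.Theory ComplexField.Normc.
Local Open Scope sesquilinear_scope.

Section Inner.
Variables (R : realType) (M : nat).
Implicit Types x y f : 'cV[R[i]]_M.

Lemma innerD x y f : inner (x + y) f = inner x f + inner y f.
Proof. by rewrite /inner mulmxDr mxE. Qed.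

Lemma innerZ a x f : inner (a *: x) f = a * inner x f.
Proof. by rewrite /inner -scalemxAr mxE. Qed.

Lemma innerN x f : inner (- x) f = - inner x f.
Proof. by rewrite -scaleN1r innerZ mulN1r. Qed.

Lemma inner0 f : inner 0 f = 0.
Proof. by rewrite /inner mulmx0 mxE. Qed.

End Inner.

Section Frame.
Variables (R : realType) (M N : nat) (phi : 'I_N -> 'cV[R[i]]_M).

(** Put the vectors of [S] in the rows of a matrix, with zero rows elsewhere: either its rank is
    [M], or its entrywise conjugate, of the same rank, kills some nonzero column. *)
Lemma spans_or_orthogonal (S : {set 'I_N}) :
  spans phi S \/
  exists2 u : 'cV[R[i]]_M, u != 0 & forall n, n \in S -> inner u (phi n) = 0.
Proof.
pose B := \matrix_(n < N) (if n \in S then (phi n)^T else 0).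
have [fullB | nfullB] := boolP (row_full B).
  left; apply/eqP; rewrite eqEsubv subvf; apply/subvP => v _.
  have /submxP[D vE] : (v^T <= B)%MS by apply: submx_full.
  have -> : v = \sum_n D 0 n *: (row n B)^T.
    rewrite -[v]trmxK vE mulmx_sum_row raddf_sum /=.
    by apply: eq_bigr => n _; rewrite linearZ.
  apply: memv_suml => n _; apply: memvZ; rewrite rowK.
  case: ifP => nS; last by rewrite trmx0 mem0v.
  by rewrite trmxK; apply/memv_span/image_f.
right.
(* For [n] in [S], row [n] of [A] is the conjugate transpose of [phi n], so [A *m u = 0] is the
   required orthogonality; [kermx] is a left kernel, hence [A^T]. *)
pose A := B ^ Num.conj.
have /rowV0Pn[w wA w0] : kermx A^T != 0.
  by rewrite kermx_eq0 /row_free mxrank_tr mxrank_map.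
exists w^T; first by rewrite trmx_eq0.
move=> n nS; rewrite /inner.
have /(congr1 trmx) := sub_kermxP wA.
rewrite trmx_mul trmxK trmx0 => /(congr1 (row n)).
rewrite row_mul row0 -map_row rowK nS => ->.
by rewrite mxE.
Qed.

End Frame.

Theorem theorem7 (R : realType) (M N : nat) (phi : 'I_N -> 'cV[R[i]]_M) :
  intensity_injective phi -> complement_property phi.
Proof.
move=> inj S.
have [|[u u0 uS]] := spans_or_orthogonal R M N phi S; first by left.
have [|[v v0 vS]] := spans_or_orthogonal R M N phi (~: S); first by right.
have v_perp n : n \notin S -> inner v (phi n) = 0.
  by move=> nS; apply: vS; rewrite inE.
have [|c _ uvE] := inj (u + v) (u - v).
  (* On [S] only the [v] term survives, up to sign; off [S] only the [u] term. *)
  apply/rowP => n; rewrite !mxE !innerD innerN.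
  have [nS | nS] := boolP (n \in S).
    by rewrite uS // !add0r normcN.
  by rewrite v_perp // oppr0.
have propuv : (1 - c) *: u = (1 + c) *: v.
  rewrite scalerBl scalerDl !scale1r; apply/eqP.
  by rewrite subr_eq -addrA -scalerDr [v + u]addrC -uvE addrC subrK.
(* If [c = -1], then [propuv] reads [2 u = 0]. *)
have c1 : 1 + c != 0.
  apply: contraNneq u0 => c1; move/eqP: propuv.
  rewrite c1 scale0r scaler_eq0 => /orP[|//].
  move/eqP: c1; rewrite addrC addr_eq0 => /eqP ->.
  by rewrite opprK -[1 + 1]/(2%:R) pnatr_eq0.
have v_perp_all n : inner v (phi n) = 0.
  have [nS | /v_perp //] := boolP (n \in S).
  (* On [S], orthogonality passes from [u] to [v] through [propuv]. *)
  apply: (mulfI c1); rewrite -innerZ -propuv innerZ uS //.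
  by rewrite !mulr0.
have [|a _ ] := inj 0 v.
  by apply/rowP => n; rewrite !mxE inner0 v_perp_all.
by rewrite scaler0 => /eqP; rewrite (negPf v0).
Qed.
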